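(* Let $\varphi : R \to S$ be a flat ring map with $S$ Noetherian, let $M$ be an $R$-module, and let $\mathfrak{p} \in \operatorname{Ass}_R(M)$. Then either $\mathfrak{p} S = S$ or there exists $\mathfrak{q} \in \operatorname{Ass}_S(M \otimes_R S)$ with $\mathfrak{p} = \varphi^{-1}(\mathfrak{q})$.
   Context: All rings are commutative with $1 \neq 0$, and ring maps take $1$ to $1$; $R$ is not assumed Noetherian. A ring map $R \to S$ is flat if $S$ is flat as an $R$-module. For a module $M$ over a ring $R$, $\operatorname{Ass}_R(M)$ is the set of primes $\mathfrak{p}$ of $R$ that are annihilators of elements of $M$, equivalently such that there is an injective $R$-module map $R/\mathfrak{p} \hookrightarrow M$. $\mathfrak{p}S$ denotes the ideal of $S$ generated by $\varphi(\mathfrak{p})$. *)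

(* Defs.v *)
From HB Require Import structures.
From mathcomp Require Import all_boot all_algebra.
From mathcomp Require Import generic_quotient ring_quotient.
From mathcomp Require Import boolp classical_sets.
From mathcomp Require Import freeg.

Set Implicit Arguments.
Unset Strict Implicit.
Unset Printing Implicit Defensive.

Import GRing.Theory.
Local Open Scope classical_set_scope.
Local Open Scope ring_scope.
Local Open Scope quotient_scope.

(* ------------------------------------------------------------------ *)
Section Span.
Context (R : nzRingType) (V : lmodType R).

(* The submodule generated by A, as a (classically decided) boolean
   predicate. Arbitrary ideals of R are handled as submodules of R^o, since
   [idealr_closed] only covers proper ideals. *)
Definition span (A : set V) : {pred V} := fun x =>
  `[< forall W : {pred V},
        submod_closed W -> {in A, forall a, a \in W} -> x \in W >].

Lemma spanP (A : set V) x :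
  reflect (forall W : {pred V},
             submod_closed W -> {in A, forall a, a \in W} -> x \in W)
          (x \in span A).
Proof. exact: asboolP. Qed.

Lemma mem_span (A : set V) a : A a -> a \in span A.
Proof. by move=> Aa; apply/spanP => W _; apply; rewrite inE. Qed.

Lemma span_submod_closed (A : set V) : submod_closed (span A).
Proof.
split=> [|r x y /spanP xA /spanP yA]; apply/spanP => W cW AW.
  by case: cW.
by have [_ linW] := cW; apply: linW; [apply: xA|apply: yA].
Qed.

HB.instance Definition _ (A : set V) :=
  GRing.isSubmodClosed.Build R V (span A) (span_submod_closed A).

End Span.

(* ------------------------------------------------------------------ *)
Section QuotientModule.
Context (R : nzRingType) (V : lmodType R) (W : submodClosed V).

(* [submodClosed] does not inherit from [zmodClosed]. *)
Definition submod_pred : {pred V} := fun x => x \in W.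

Fact submod_pred_zmod_closed : zmod_closed submod_pred.
Proof.
split=> [|x y Wx Wy]; first exact: (rpred0 W).
by rewrite -[_ \in _]/(_ \in W) -scaleN1r rpredD // rpredZ.
Qed.

HB.instance Definition _ :=
  GRing.isZmodClosed.Build V submod_pred submod_pred_zmod_closed.

Definition quotient_module : Type := {ideal_quot submod_pred}.

HB.instance Definition _ := GRing.Zmodule.on quotient_module.

Definition qmod_proj (x : V) : quotient_module := \pi_({ideal_quot submod_pred}) x.
Definition qmod_repr (z : quotient_module) : V := repr (z : {ideal_quot submod_pred}).

Lemma qmod_reprK : cancel qmod_repr qmod_proj.
Proof. exact: reprK. Qed.

Lemma qmod_projP (x y : V) : reflect (qmod_proj x = qmod_proj y) (x - y \in W).
Proof. by rewrite -[_ \in W]/(_ \in submod_pred) Quotient.idealrBE; apply: eqP. Qed.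

Lemma qmod_projB : {morph qmod_proj : x y / x - y}.
Proof. exact: raddfB. Qed.

Lemma qmod_projD : {morph qmod_proj : x y / x + y}.
Proof. exact: raddfD. Qed.

Definition qmod_scale (r : R) (z : quotient_module) : quotient_module :=
  qmod_proj (r *: qmod_repr z).

Lemma qmod_scaleE r x : qmod_scale r (qmod_proj x) = qmod_proj (r *: x).
Proof.
by apply/qmod_projP; rewrite -scalerBr rpredZ //; apply/qmod_projP/qmod_reprK.
Qed.

Fact qmod_scaleA a b z : qmod_scale a (qmod_scale b z) = qmod_scale (a * b) z.
Proof. by rewrite -[z]qmod_reprK !qmod_scaleE scalerA. Qed.

Fact qmod_scale1 : left_id 1 qmod_scale.
Proof. by move=> z; rewrite -[z]qmod_reprK qmod_scaleE scale1r. Qed.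

Fact qmod_scaleDr : right_distributive qmod_scale +%R.
Proof.
move=> a z t; rewrite -[z]qmod_reprK -[t]qmod_reprK.
by rewrite -qmod_projD !qmod_scaleE scalerDr qmod_projD.
Qed.

Fact qmod_scaleDl z : {morph qmod_scale^~ z : a b / a + b}.
Proof.
by move=> a b; rewrite -[z]qmod_reprK !qmod_scaleE scalerDl qmod_projD.
Qed.

HB.instance Definition _ := GRing.Zmodule_isLmodule.Build R quotient_module
  qmod_scaleA qmod_scale1 qmod_scaleDr qmod_scaleDl.

Fact qmod_proj_linear : linear qmod_proj.
Proof. by move=> a x y; rewrite qmod_projD -qmod_scaleE. Qed.

HB.instance Definition _ :=
  GRing.isLinear.Build R V quotient_module _ qmod_proj qmod_proj_linear.

End QuotientModule.

(* ------------------------------------------------------------------ *)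
Section TensorProduct.
Context (R : comNzRingType) (M N : lmodType R).

Inductive tensor_rel : set {freeg (M * N)%type / R} :=
| TensorAddl m m' n :
    tensor_rel (<< (m + m', n) >> - << (m, n) >> - << (m', n) >>)
| TensorAddr m n n' :
    tensor_rel (<< (m, n + n') >> - << (m, n) >> - << (m, n') >>)
| TensorScalel r m n :
    tensor_rel (<< (r *: m, n) >> - r *: << (m, n) >>)
| TensorScaler r m n :
    tensor_rel (<< (m, r *: n) >> - r *: << (m, n) >>).

Definition tensor : Type := quotient_module (span tensor_rel).

HB.instance Definition _ := GRing.Lmodule.on tensor.

Definition tens (m : M) (n : N) : tensor :=
  qmod_proj (span tensor_rel) << (m, n) >>.

Fact tens_linearl n : linear (tens ^~ n).
Proof.
have Dl m m' : tens (m + m') n = tens m n + tens m' n.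
  rewrite /tens -qmod_projD; apply/qmod_projP; rewrite opprD addrA.
  exact/mem_span/TensorAddl.
have Zl r m : tens (r *: m) n = r *: tens m n.
  rewrite /tens -linearZ; apply/qmod_projP.
  exact/mem_span/TensorScalel.
by move=> r m m'; rewrite Dl Zl.
Qed.

Fact tens_linearr m : linear (tens m).
Proof.
have Dr n n' : tens m (n + n') = tens m n + tens m n'.
  rewrite /tens -qmod_projD; apply/qmod_projP; rewrite opprD addrA.
  exact/mem_span/TensorAddr.
have Zr r n : tens m (r *: n) = r *: tens m n.
  rewrite /tens -linearZ; apply/qmod_projP.
  exact/mem_span/TensorScaler.
by move=> r n n'; rewrite Dr Zr.
Qed.

Section Lift.
Context (P : lmodType R) (f : M -> N -> P).

(* Meaningful only for bilinear f, see [tensor_liftE]. *)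
Definition tensor_lift (z : tensor) : P :=
  fglift (fun mn => f mn.1 mn.2) (qmod_repr z).

Hypotheses (fl : forall n, linear (f ^~ n)) (fr : forall m, linear (f m)).

Let F := fglift (fun mn : M * N => f mn.1 mn.2).

Let F_linear : linear F.
Proof.
have FB : {morph F : x y / x - y} by exact: lift_is_additive.
have F0 : F 0 = 0 by rewrite -(subrr 0) FB subrr.
have FD : {morph F : x y / x + y}.
  by move=> x y; rewrite -[y in LHS]opprK -[- y]sub0r !FB F0 sub0r opprK.
have FS I (s : seq I) (E : I -> {freeg (M * N)%type / R}) :
    F (\sum_(i <- s) E i) = \sum_(i <- s) F (E i).
  by apply: (big_morph F FD F0).
move=> a x y; rewrite FD; congr (_ + _).
rewrite -[in RHS](freeg_sumE x) FS scaler_sumr.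
have -> : a *: x = \sum_(z <- dom x) << a * coeff z x *g z >> by [].
by rewrite FS; apply: eq_bigr => z _; rewrite /F !liftU scalerA.
Qed.

Let FL : {linear {freeg (M * N)%type / R} -> P} :=
  HB.pack F (GRing.isLinear.Build _ _ _ _ F F_linear).

Lemma tensor_lift_proj x : tensor_lift (qmod_proj _ x) = F x.
Proof.
apply/eqP; rewrite -subr_eq0 -[tensor_lift _]/(FL _) -[F x]/(FL x) -linearB.
have /qmod_projP := qmod_reprK (qmod_proj (span tensor_rel) x).
move=> /spanP /(_ [pred z | FL z == 0]); rewrite inE; apply.
  split=> [|a u v]; rewrite !inE ?linear0 //.
  by move=> /eqP u0 /eqP v0; rewrite linearP u0 v0 scaler0 addr0.
have fDl m m' n : f (m + m') n = f m n + f m' n.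
  by have := fl n 1 m m'; rewrite !scale1r.
have fDr m n n' : f m (n + n') = f m n + f m n'.
  by have := fr m 1 n n'; rewrite !scale1r.
have f0l n : f 0 n = 0 by apply: (addrI (f 0 n)); rewrite -fDl !addr0.
have f0r m : f m 0 = 0 by apply: (addrI (f m 0)); rewrite -fDr !addr0.
have fZl r m n : f (r *: m) n = r *: f m n.
  by have := fl n r m 0; rewrite !addr0 f0l addr0.
have fZr r m n : f m (r *: n) = r *: f m n.
  by have := fr m r n 0; rewrite !addr0 f0r addr0.
have FLU m n : FL << (m, n) >> = f m n by rewrite /= /F liftU scale1r.
move=> z; rewrite inE => -[m m' n|m n n'|r m n|r m n]; rewrite inE.
- by rewrite !linearB !FLU fDl addrAC addrK subrr.
- by rewrite !linearB !FLU fDr addrAC addrK subrr.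
- by rewrite linearB linearZ !FLU fZl subrr.
- by rewrite linearB linearZ !FLU fZr subrr.
Qed.

Lemma tensor_liftE m n : tensor_lift (tens m n) = f m n.
Proof. by rewrite tensor_lift_proj /F liftU scale1r. Qed.

Lemma tensor_lift_linear : linear tensor_lift.
Proof.
move=> a z t; rewrite -[z]qmod_reprK -[t]qmod_reprK -linearP /=.
by rewrite !tensor_lift_proj F_linear.
Qed.

End Lift.

Lemma tensor_ind (K : tensor -> Prop) :
    K 0 -> (forall m n z, K z -> K (tens m n + z)) -> forall z, K z.
Proof.
move=> K0 KD z; rewrite -[z]qmod_reprK -[qmod_repr z]freeg_sumE linear_sum.
elim: (dom _) => [|[m n] s IHs]; first by rewrite big_nil.
rewrite big_cons; set c := coeff _ _; set u := (X in X + _).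
suff -> : u = tens (c *: m) n by exact: KD.
have -> : u = qmod_proj (span tensor_rel) (c *: << (m, n) >>).
  congr (qmod_proj _ _); apply/eqP/freeg_eqP => k.
  by rewrite coeffZ !coeffU mul1r.
have -> : qmod_proj (span tensor_rel) (c *: << (m, n) >>) = c *: tens m n.
  exact: linearZ.
have Z0 : tens 0 n = 0.
  apply: (addIr (tens 0 n)).
  by have := tens_linearl n 1 0 0; rewrite !scale1r addr0 add0r.
by have := tens_linearl n c m 0; rewrite Z0 !addr0.
Qed.

End TensorProduct.

Section TensorMap.
Context (R : comNzRingType) (M M' N N' : lmodType R).

Definition tensor_map (f : {linear M -> M'}) (g : {linear N -> N'}) :
    tensor M N -> tensor M' N' :=
  tensor_lift (fun m n => tens (f m) (g n)).

Context (f : {linear M -> M'}) (g : {linear N -> N'}).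

Let bl n : linear (fun m => tens (f m) (g n)).
Proof. by move=> a x y; rewrite linearP tens_linearl. Qed.

Let br m : linear (fun n => tens (f m) (g n)).
Proof. by move=> a x y; rewrite linearP tens_linearr. Qed.

Lemma tensor_mapE m n : tensor_map f g (tens m n) = tens (f m) (g n).
Proof. exact: (tensor_liftE bl br). Qed.

Lemma tensor_map_linear : linear (tensor_map f g).
Proof. exact: (tensor_lift_linear bl br). Qed.

HB.instance Definition _ :=
  GRing.isLinear.Build R (tensor M N) (tensor M' N') _ (tensor_map f g)
    tensor_map_linear.

End TensorMap.

(* ------------------------------------------------------------------ *)
(* V viewed as an R-module; phi must stay an argument of [restrict], since
   the R-module structure below depends on it. *)
Definition restrict (R S : comNzRingType) (phi : {rmorphism R -> S})
  (V : lmodType S) : Type := V.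

Section Restriction.
Context (R S : comNzRingType) (phi : {rmorphism R -> S}) (V : lmodType S).

Local Notation restrict := (restrict phi V).

HB.instance Definition _ := GRing.Zmodule.on restrict.

Definition restrict_scale (r : R) (v : restrict) : restrict :=
  phi r *: (v : V).

Fact restrict_scaleA a b v :
  restrict_scale a (restrict_scale b v) = restrict_scale (a * b) v.
Proof. by rewrite /restrict_scale scalerA rmorphM. Qed.

Fact restrict_scale1 : left_id 1 restrict_scale.
Proof. by move=> v; rewrite /restrict_scale rmorph1 scale1r. Qed.

Fact restrict_scaleDr : right_distributive restrict_scale +%R.
Proof. by move=> a u v; apply: (scalerDr (phi a) (u : V) (v : V)). Qed.

Fact restrict_scaleDl v : {morph restrict_scale^~ v : a b / a + b}.
Proof. by move=> a b; rewrite /restrict_scale rmorphD scalerDl. Qed.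

HB.instance Definition _ := GRing.Zmodule_isLmodule.Build R restrict
  restrict_scaleA restrict_scale1 restrict_scaleDr restrict_scaleDl.

End Restriction.

(* ------------------------------------------------------------------ *)
(* M (x)_R S as an S-module: s acts by id (x) (multiplication by s). *)
Section BaseChange.
Context (R S : comNzRingType) (phi : {rmorphism R -> S}) (M : lmodType R).

Local Notation S_R := (restrict phi S^o).

Definition base_change : Type := tensor M S_R.

HB.instance Definition _ := GRing.Zmodule.on base_change.

Definition restrict_mul (s : S) (t : S_R) : S_R := s * (t : S).

Fact restrict_mul_linear s : linear (restrict_mul s).
Proof.
move=> a x y; rewrite /restrict_mul -[RHS]/(phi a * (s * (x : S)) + s * (y : S)).
by rewrite -[_ + y]/(phi a * (x : S) + (y : S)) mulrDr mulrCA.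
Qed.

HB.instance Definition _ s :=
  GRing.isLinear.Build R S_R S_R _ (restrict_mul s) (restrict_mul_linear s).

Definition base_change_scale (s : S) (z : base_change) : base_change :=
  tensor_map idfun (restrict_mul s) z.

Lemma base_change_scaleE s m (t : S_R) :
  base_change_scale s (tens m t) = tens m (restrict_mul s t).
Proof. exact: tensor_mapE. Qed.

Let scale0 s : base_change_scale s 0 = 0.
Proof. exact: linear0. Qed.

Fact base_change_scaleDr : right_distributive base_change_scale +%R.
Proof. by move=> s z t; apply: linearD. Qed.

Fact base_change_scaleA a b z :
  base_change_scale a (base_change_scale b z) = base_change_scale (a * b) z.
Proof.
elim/tensor_ind: z => [|m t z IHz]; first by rewrite !scale0.
rewrite !base_change_scaleDr IHz !base_change_scaleE; congr (tens _ _ + _).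
exact: mulrA.
Qed.

Fact base_change_scale1 : left_id 1 base_change_scale.
Proof.
elim/tensor_ind => [|m t z IHz]; first by rewrite scale0.
rewrite base_change_scaleDr IHz base_change_scaleE; congr (tens _ _ + _).
exact: mul1r.
Qed.

Fact base_change_scaleDl z : {morph base_change_scale^~ z : a b / a + b}.
Proof.
move=> a b; elim/tensor_ind: z => [|m t z IHz]; first by rewrite !scale0 addr0.
rewrite !base_change_scaleDr IHz !base_change_scaleE addrACA; congr (_ + _).
have -> : restrict_mul (a + b) t = restrict_mul a t + restrict_mul b t.
  exact: mulrDl.
by have := tens_linearr m 1 (restrict_mul a t) (restrict_mul b t); rewrite !scale1r.
Qed.

HB.instance Definition _ := GRing.Zmodule_isLmodule.Build S base_change
  base_change_scaleA base_change_scale1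
  base_change_scaleDr base_change_scaleDl.

End BaseChange.

(* ------------------------------------------------------------------ *)
Definition flat_module (R : comNzRingType) (N : lmodType R) : Prop :=
  forall (M M' : lmodType R) (f : {linear M -> M'}),
    injective f -> injective (tensor_map f (idfun : {linear N -> N})).

Definition flat_ring_map (R S : comNzRingType) (phi : {rmorphism R -> S}) :
  Prop := flat_module (restrict phi S^o).

Definition noetherian (R : comNzRingType) : Prop :=
  forall I : {pred R^o}, submod_closed I ->
    exists s : seq R^o, I =i span [set` s].

(* [idealr_closed] includes 1 \notin p. *)
Definition prime_ideal (R : comNzRingType) (p : {pred R}) : Prop :=
  idealr_closed p /\ prime_idealr_closed p.

Definition annihilator (R : comNzRingType) (M : lmodType R) (x : M) :
  {pred R} := [pred r | r *: x == 0].

Definition Ass (R : comNzRingType) (M : lmodType R) : set {pred R} :=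
  [set p | prime_ideal p /\ exists x : M, p =i annihilator x].

Definition extended_ideal (R S : comNzRingType) (phi : {rmorphism R -> S})
  (I : {pred R}) : {pred S} := span (phi @` [set` I] : set S^o).

(* Main.v *)
From HB Require Import structures.
Require Import Defs.
From mathcomp Require Import all_boot all_algebra.
From mathcomp Require Import boolp classical_sets.

(** Write p = ann(x) with x in M and let z = x (x) 1 in M (x)_R S.

    The role of flatness is to make relations on x the only source of
    relations on the tensors x (x) n.  Since R/ann(x) embeds in M by 1 |-> x,
    x (x) n vanishes only if 1 (x) n already vanishes in R/ann(x) (x) N, and
    then y (x) n vanishes for every y, in any module, that is killed by ann(x)
    ([flat_tens_eq0]).  Two choices of y are used:
    - y = the class of 1 in S/pS, which shows that z <> 0 unless pS = S, because
      y (x) 1 is sent to y by the action of S on S/pS;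
    - y = x, with r x in place of x, for r outside p.  As p is prime,
      ann(r x) = ann(x), so x (x) s = 0 as soon as phi(r) (x (x) s) = r x (x) s
      is 0: elements of R outside p act injectively on the submodule S z of
      M (x)_R S.

    Assume pS <> S, so that S z <> 0.  As S is Noetherian, the annihilators of
    nonzero elements of S z have a maximal member q = ann(s z), and such a
    q is prime ([noetherian_exists_prime_annihilator]).  It contains phi(p),
    since phi(p) kills z, and phi(r) is not in q for r outside p, since phi(r)
    acts injectively on S z while s z <> 0.  Hence phi^-1(q) = p. *)

Set Implicit Arguments.
Unset Strict Implicit.
Unset Printing Implicit Defensive.

Import GRing.Theory.
Local Open Scope classical_set_scope.
Local Open Scope ring_scope.

(** * Prime annihilators over a Noetherian ring *)

Lemma annihilator_submod_closed (R : comNzRingType) (M : lmodType R) (x : M) :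
  submod_closed (annihilator x : {pred R^o}).
Proof.
split=> [|a u v]; rewrite !inE ?scale0r // => /eqP ux0 /eqP vx0.
by rewrite scalerDl vx0 addr0 -[a *: u]/(a * u) -scalerA ux0 scaler0.
Qed.

Section NoetherianMaximal.
Context (R : comNzRingType).
Hypothesis R_noeth : noetherian R.

(** The union of the chain is generated by finitely many elements, and these
    already lie in one I n. *)
Lemma noetherian_chain_stationary (I : nat -> {pred R^o}) :
    (forall n, submod_closed (I n)) -> (forall n, {subset I n <= I n.+1}) ->
  exists n, {subset I n.+1 <= I n}.
Proof.
move=> cI sI.
have le_I m n : (m <= n)%N -> {subset I m <= I n}.
  move=> /subnK <-; elim: (n - m)%N => // k IHk a /IHk.
  exact: sI.
pose U : {pred R^o} := fun a => `[< exists n, a \in I n >].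
have UP a : reflect (exists n, a \in I n) (a \in U) by exact: asboolP.
have cU : submod_closed U.
  split=> [|a u v /UP[m Imu] /UP[n Inv]]; apply/UP.
    by exists 0%N; case: (cI 0%N).
  exists (maxn m n); have [_] := cI (maxn m n); apply.
    exact: (le_I _ _ (leq_maxl m n)).
  exact: (le_I _ _ (leq_maxr m n)).
have [s Us] := R_noeth cU.
have sU : {subset s <= U} by move=> a sa; rewrite Us; exact: mem_span.
have [n sIn] : exists n, {subset s <= I n}.
  elim: s sU {Us} => [|a s IHs] sU; first by exists 0%N.
  have /UP[m Ima] := sU a (mem_head a s).
  have [|n sIn] := IHs; first by move=> b sb; apply: sU; rewrite inE sb orbT.
  exists (maxn m n) => b; rewrite inE => /orP[/eqP->|/sIn].
    exact: (le_I _ _ (leq_maxl m n)).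
  exact: (le_I _ _ (leq_maxr m n)).
exists n => a Ia; have : a \in U by apply/UP; exists n.+1.
by rewrite Us => /spanP; apply=> // b; rewrite inE => /sIn.
Qed.

(** Without a maximal member, dependent choice produces a strictly increasing
    chain in F. *)
Lemma noetherian_exists_maximal (F : set {pred R^o}) :
    (forall I, F I -> submod_closed I) -> (exists I, F I) ->
  exists2 I, F I & forall J, F J -> {subset I <= J} -> {subset J <= I}.
Proof.
move=> cF [I0 FI0]; apply: contrapT => no_max.
have next (I : {I | F I}) :
    {J : {I | F I} | {subset sval I <= sval J} /\ ~ {subset sval J <= sval I}}.
  apply/cid; case: I => I FI /=; apply: contrapT => noJ; apply: no_max.
  exists I => // J FJ sIJ; apply: contrapT => nsJI.
  by apply: noJ; exists (exist _ J FJ).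
have [I [_ stepI]] := dependent_choice next (exist _ I0 FI0).
have [n|n|n sI] := @noetherian_chain_stationary (fun n => sval (I n)).
- by apply: cF; exact: svalP.
- by have [] := stepI n.
- by have [_] := stepI n; apply.
Qed.

End NoetherianMaximal.

(** If ann(s z) is maximal among the annihilators of nonzero multiples of z and
    u v s z = 0 with v s z <> 0, then ann(v s z) contains ann(s z) and u, so u
    lies in ann(s z). *)
Lemma noetherian_exists_prime_annihilator (S : comNzRingType) (N : lmodType S)
    (z : N) :
  noetherian S -> z != 0 ->
  exists2 s : S, s *: z != 0 & prime_ideal (annihilator (s *: z)).
Proof.
move=> S_noeth z0.
pose F : set {pred S^o} :=
  [set I | exists2 s : S, s *: z != 0 & I = annihilator (s *: z)].
have cF I : F I -> submod_closed I.
  by move=> [s _ ->]; exact: annihilator_submod_closed.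
have [|_ [s sz0 ->] max_s] := noetherian_exists_maximal S_noeth cF.
  by exists (annihilator z), 1; rewrite scale1r.
exists s => //; have [ann0 annL] := annihilator_submod_closed (s *: z).
split; first by split=> //; rewrite inE scale1r.
move=> u v uv; case: (boolP (v \in _)) => [|vsz0]; rewrite ?orbT // orbF.
have FJ : F (annihilator (v *: (s *: z))).
  by exists (v * s); rewrite -scalerA.
apply: (max_s _ FJ) => [a|]; rewrite !inE.
  by move=> /eqP asz0; rewrite scalerA mulrC -scalerA asz0 scaler0.
by rewrite scalerA.
Qed.

(** Multiplication by r is injective on the domain R/ann(x), which is isomorphic
    to R x. *)
Lemma prime_annihilatorZ (R : comNzRingType) (M : lmodType R) (x : M) (r : R) :
    prime_ideal (annihilator x) -> r \notin annihilator x ->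
  {subset annihilator (r *: x) <= annihilator x}.
Proof.
move=> [_ prime_x] rx a; rewrite inE scalerA => arx.
by have /orP[] := prime_x a r arx; rewrite // (negPf rx).
Qed.

(** * Flatness and the vanishing of pure tensors *)

Section FlatTens.
Context (R : comNzRingType).

Section Cyclic.
Context (M : lmodType R) (x : M).

HB.instance Definition _ := GRing.isSubmodClosed.Build R R^o
  (annihilator x : {pred R^o}) (annihilator_submod_closed x).

Definition cyclic_module : Type :=
  quotient_module (annihilator x : {pred R^o}).

HB.instance Definition _ := GRing.Lmodule.on cyclic_module.

Definition cyclic_gen : cyclic_module :=
  qmod_proj (annihilator x : {pred R^o}) 1.

Lemma cyclic_moduleP (c : cyclic_module) : exists r : R, c = r *: cyclic_gen.
Proof.
exists (qmod_repr c); rewrite -[LHS]qmod_reprK -linearZ.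
by congr (qmod_proj _ _); rewrite -[RHS]/(_ * 1) mulr1.
Qed.

Lemma cyclic_map (M' : lmodType R) (y : M') :
    {subset annihilator x <= annihilator y} ->
  exists f : {linear cyclic_module -> M'}, f cyclic_gen = y.
Proof.
move=> sxy; pose f (c : cyclic_module) : M' := (qmod_repr c : R) *: y.
have fE (r : R) : f (qmod_proj _ (r : R^o)) = r *: y.
  apply/eqP; rewrite -subr_eq0 -scalerBl; apply: sxy.
  exact/qmod_projP/qmod_reprK.
have f_linear : linear f.
  move=> a c d; rewrite -[c]qmod_reprK -[d]qmod_reprK -linearP !fE.
  by rewrite scalerDl -[a *: qmod_repr c]/(a * _) -scalerA.
pose fL : {linear cyclic_module -> M'} :=
  HB.pack f (GRing.isLinear.Build _ _ _ _ f f_linear).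
by exists fL; rewrite /= fE scale1r.
Qed.

Lemma cyclic_map_inj (f : {linear cyclic_module -> M}) :
  f cyclic_gen = x -> injective f.
Proof.
move=> fx c d /eqP; rewrite -subr_eq0 -linearB => fcd0.
apply/eqP; rewrite -subr_eq0; have [r cdE] := cyclic_moduleP (c - d).
move: fcd0; rewrite {}cdE linearZ fx /= => rx0; apply/eqP.
rewrite -linearZ -[RHS](linear0 (qmod_proj (annihilator x : {pred R^o}))).
by apply/qmod_projP; rewrite subr0 -[_ *: _]/(r * 1) mulr1.
Qed.

End Cyclic.

(** Both x (x) n and y (x) n are images of 1 (x) n in R/ann(x) (x) N, the first
    one under an injection. *)
Lemma flat_tens_eq0 (N M M' : lmodType R) (x : M) (y : M') (n : N) :
    flat_module N -> {subset annihilator x <= annihilator y} ->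
  tens x n = 0 -> tens y n = 0.
Proof.
move=> flatN sxy xn0.
have [f fx] := cyclic_map (x := x) (y := x) (fun _ h => h).
have [g <-] := cyclic_map sxy.
have gen0 : tens (cyclic_gen x) n = 0.
  apply: (flatN _ _ _ (cyclic_map_inj fx)).
  by rewrite tensor_mapE fx linear0.
by rewrite -[n]/(idfun n) -(tensor_mapE g idfun) gen0 linear0.
Qed.

End FlatTens.

(** * Pure tensors in a base change *)

Section TensBilinear.
Context (R : comNzRingType) (M N : lmodType R).

Lemma tens0l (n : N) : tens (0 : M) n = 0.
Proof.
by have := tens_linearl n (-1) (0 : M) 0; rewrite /= scaler0 addr0 scaleN1r addNr.
Qed.

Lemma tens0r (m : M) : tens m (0 : N) = 0.
Proof.
by have := tens_linearr m (-1) (0 : N) 0; rewrite /= scaler0 addr0 scaleN1r addNr.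
Qed.

Lemma tensZl (r : R) (m : M) (n : N) : tens (r *: m) n = r *: tens m n.
Proof. by have := tens_linearl n r m 0; rewrite tens0l !addr0. Qed.

Lemma tensZr (r : R) (m : M) (n : N) : tens m (r *: n) = r *: tens m n.
Proof. by have := tens_linearr m r n 0; rewrite tens0r !addr0. Qed.

End TensBilinear.

(** The action V (x)_R S -> V is a retraction of v |-> v (x) 1. *)
Lemma tens_restrict_eq0 (R S : comNzRingType) (phi : {rmorphism R -> S})
    (V : lmodType S) (v : V) :
  tens (v : restrict phi V) ((1 : S) : restrict phi S^o) = 0 -> v = 0.
Proof.
pose act (u : restrict phi V) (s : restrict phi S^o) : restrict phi V :=
  (s : S) *: (u : V).
have act_l s : linear (act ^~ s).
  move=> a u w; rewrite /act scalerDr; congr (_ + _).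
  rewrite -[a *: u]/(phi a *: (u : V)) scalerA mulrC.
  by rewrite -scalerA.
have act_r u : linear (act u).
  move=> a s t; rewrite /act -[a *: s]/(phi a * (s : S)) scalerDl.
  by rewrite -scalerA.
move=> v10; rewrite -[LHS](scale1r (v : V)).
rewrite -[LHS](tensor_liftE act_l act_r v ((1 : S) : restrict phi S^o)) v10.
pose actL : {linear tensor (restrict phi V) (restrict phi S^o)
                   -> restrict phi V} :=
  HB.pack (tensor_lift act)
    (GRing.isLinear.Build _ _ _ _ _ (tensor_lift_linear act_l act_r)).
exact: (linear0 actL).
Qed.

Section BaseChange.
Context (R S : comNzRingType) (phi : {rmorphism R -> S}) (M : lmodType R).

(** The pure tensor x (x) s, typed so that S acts on it: [tens x s] itself only
    carries the R-module structure of the tensor product. *)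
Definition btens (x : M) (s : S) : base_change phi M :=
  tens x (s : restrict phi S^o).

Lemma btens_scale (s t : S) (x : M) : s *: btens x t = btens x (s * t).
Proof. exact: base_change_scaleE. Qed.

Lemma btens_scale_morph (r : R) (s : S) (x : M) :
  phi r *: btens x s = btens (r *: x) s.
Proof. by rewrite btens_scale /btens tensZl -tensZr. Qed.

(** The class y of 1 in S/pS is killed by p = ann(x), so y (x) 1 vanishes along
    with x (x) 1; hence y = 0, that is, pS contains 1. *)
Lemma flat_btens1_eq0 (x : M) :
    flat_ring_map phi -> btens x 1 = 0 ->
  extended_ideal phi (annihilator x) =i predT.
Proof.
move=> phi_flat x0; pose A : set S^o := phi @` [set` annihilator x].
pose y : quotient_module (Defs.span A) := qmod_proj (Defs.span A) 1.
have /(tens_restrict_eq0 (phi := phi)) y0 :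
    tens (y : restrict phi _) ((1 : S) : restrict phi S^o) = 0.
  apply: flat_tens_eq0 phi_flat _ x0 => r rx; rewrite inE.
  rewrite -[r *: _]/(phi r *: y) -linearZ; apply/eqP.
  rewrite -[RHS](linear0 (qmod_proj (Defs.span A))); apply/qmod_projP.
  rewrite subr0 -[_ *: _]/(_ * 1) mulr1; apply: mem_span.
  by exists r.
have : (1 : S^o) \in Defs.span A.
  rewrite -[1]subr0; apply/qmod_projP.
  by rewrite linear0; exact: y0.
move=> one s; rewrite [RHS]inE -[s]mulr1; exact: (rpredZ s one).
Qed.

End BaseChange.

Theorem proposition1 (R S : comNzRingType) (phi : {rmorphism R -> S})
    (phi_flat : flat_ring_map phi) (S_noetherian : noetherian S)
    (M : lmodType R) (p : {pred R}) (p_ass : Ass M p) :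
  extended_ideal phi p =i predT \/
  exists2 q : {pred S}, Ass (base_change phi M) q & p =i [preim phi of q].
Proof.
case: p_ass => p_prime [x pE].
have {}pE : p = annihilator x by apply/funext.
rewrite {}pE in p_prime *.
pose z := btens phi x 1.
have [z0|z0] := eqVneq z 0; [left|right].
  exact: flat_btens1_eq0.
have [s sz0 q_prime] := noetherian_exists_prime_annihilator S_noetherian z0.
exists (annihilator (s *: z)); first by split=> //; exists (s *: z).
move: sz0; rewrite btens_scale mulr1 => sz0 r.
rewrite -[RHS]/(phi r *: btens phi x s == 0) btens_scale_morph.
apply/idP/eqP => [/eqP->|rxs0].
  exact: tens0l.
apply: contraNT sz0 => rx; apply/eqP.
by apply: flat_tens_eq0 phi_flat _ rxs0; exact: prime_annihilatorZ.
Qed.
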